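(* Let $k \geq 3$ and let $(a_1,a_2,\ldots,a_k)$ be a position of the game Max-Welter. If $a_1 \leq k-1$, then $\mathcal{G}(a_1,a_2,\ldots,a_k) = \mathcal{G}(a_2-1,a_3-1,\ldots,a_k-1)$, where the right-hand side is the value of a position with $k-1$ coins.
   Context: Max-Welter is played with a finite number of coins on a semi-infinite strip of squares labeled $0,1,2,3,\ldots$ from its left end, each square containing at most one coin. A position with $k$ coins in squares $a_1<a_2<\cdots<a_k$ (nonnegative integers) is denoted $(a_1,a_2,\ldots,a_k)$. Two players move alternately; a move consists of taking the coin in the largest occupied square $a_k$ and moving it to any empty square on its left (jumping over other coins is legal). Only the rightmost coin of the current position may be moved; after a move the coins are re-indexed in increasing order. The player first unable to move loses. The Sprague-Grundy value $\mathcal{G}(p)$ of a position $p$ is defined recursively as the smallest nonnegative integer not equal to $\mathcal{G}(q)$ for any $q$ reachable from $p$ in one move (so a terminal position has value $0$). *)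

(* Defs.v *)
From mathcomp Require Import all_boot.
From Stdlib Require Import Wf_nat.

Set Implicit Arguments.
Unset Strict Implicit.
Unset Printing Implicit Defensive.

Lemma mex_subproof (s : seq nat) : exists n, n \notin s.
Proof.
exists (sumn s).+1; apply/negP => /perm_to_rem/perm_sumn /= sumnE.
by have := leq_addr (sumn (rem (sumn s).+1 s)) (sumn s).+1; rewrite -sumnE ltnn.
Qed.

Definition mex (s : seq nat) : nat := ex_minn (mex_subproof s).

(* A position (a_1, ..., a_k) is the list of its occupied squares, in
   increasing order. *)
Definition position (s : seq nat) : bool := sorted ltn s.

(* On a position, [last 0 s] is the largest occupied square; the empty list
   has no option, since no square b satisfies b < last 0 [::] = 0. *)
Definition options (s : seq nat) : seq (seq nat) :=
  [seq sort leq (b :: rem (last 0 s) s) |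
     b <- iota 0 (last 0 s) & b \notin s].

Lemma position_options s q : position s -> q \in options s -> position q.
Proof.
rewrite /position !ltn_sorted_uniq_leq => /andP[Us _].
case/mapP=> b; rewrite mem_filter => /andP[bNs _] ->.
rewrite sort_uniq (sort_sorted leq_total) andbT /= rem_uniq // andbT.
by apply: contra bNs; apply: mem_rem.
Qed.

Lemma size_options s q : q \in options s -> size q = size s.
Proof.
case/mapP=> b; rewrite mem_filter mem_iota => /andP[_ /= lt_b] ->.
case: s lt_b => // x s lt_b.
by rewrite size_sort [RHS](perm_size (perm_to_rem (mem_last x s))).
Qed.

Lemma sumn_options s q : q \in options s -> (sumn q < sumn s)%coq_nat.
Proof.
case/mapP=> b; rewrite mem_filter mem_iota => /andP[_ /= lt_b] ->; apply/ltP.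
rewrite (perm_sumn (permEl (perm_sort _ _))) /=.
case: s lt_b => // x s lt_b.
rewrite [ltnRHS](perm_sumn (perm_to_rem (mem_last x s))) /=.
by rewrite ltn_add2r.
Qed.

(* The index type [seq_sub (options s)] ranges over the options of s, each
   packed with its membership proof, which justifies the recursive call. *)
Definition grundy_step (s : seq nat)
    (G : forall q, (sumn q < sumn s)%coq_nat -> nat) : nat :=
  mex [seq G (val q) (sumn_options (valP q)) | q : seq_sub (options s)].

Definition grundy : seq nat -> nat :=
  Fix (well_founded_ltof _ sumn) (fun _ => nat) grundy_step.

Lemma eq_mex s t : s =i t -> mex s = mex t.
Proof.
move=> st; rewrite /mex.
case: ex_minnP => m ms minm; case: ex_minnP => n nt minn.
by apply/eqP; rewrite eqn_leq minm ?minn // ?st // -st.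
Qed.

Lemma grundyE s : grundy s = mex [seq grundy q | q <- options s].
Proof.
rewrite /grundy Fix_eq; last first.
  by move=> x f g fg; congr mex; apply: eq_map => q; apply: fg.
rewrite -/grundy /grundy_step; apply: eq_mex => n.
apply/mapP/mapP => [[q _ ->]|[q qs ->]].
  by exists (val q) => //; apply: valP.
by exists (SeqSub qs); rewrite ?mem_enum.
Qed.

(* In a position every square but the first has a positive label, so the
   truncated subtraction is exact in the shift (a_2 - 1, ..., a_k - 1). *)
Lemma position_shift a :
  position a -> position [seq x - 1 | x <- behead a] /\ all (leq 1) (behead a).
Proof.
case: a => //= x s; rewrite /position /= => xs.
have s_gt0 : all (leq 1) s.
  by apply: sub_all (order_path_min ltn_trans xs) => y; apply: leq_trans.
split=> //; rewrite sorted_map.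
apply: (sub_in_sorted _ s_gt0 (path_sorted xs)) => y z y0 _ yz.
exact: ltn_sub2r (leq_ltn_trans y0 yz) yz.
Qed.

(* Main.v *)
Require Import Defs.
From mathcomp Require Import all_boot zify.

(** Induction on the sum of the squares: match the options of
    (a_1, ..., a_k) and of (a_2 - 1, ..., a_k - 1).  Moving a_k to b > a_1
    corresponds to moving a_k - 1 to b - 1, with equal values by induction.
    The moves to b < a_1 all have the value of (a_1 - 1, ..., a_(k-1) - 1) by
    induction.  That position is the option c = a_1 - 1 of the shifted
    position, all of whose options c < a_1 have one common value, again by
    induction, since c <= k - 2. *)

(** With the moving coin [m] split off at the end, the coins [u] stay fixed; [b != m] need not be
    demanded, since [b < m]. *)
Lemma mem_options_rcons (u : seq nat) (m : nat) (q : seq nat) :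
  reflect (exists2 b, (b < m) && (b \notin u) & q = sort leq (b :: u))
          (q \in options (rcons u m)).
Proof.
have sortE b : sort leq (b :: rem m (rcons u m)) = sort leq (b :: u).
  apply/(perm_sortP leq_total leq_trans anti_leq); rewrite perm_cons.
  have := @perm_to_rem _ m (rcons u m); rewrite mem_rcons mem_head => /(_ isT).
  by rewrite perm_rcons perm_cons perm_sym.
rewrite /options last_rcons; apply: (iffP mapP) => -[b bP ->]; exists b => //.
  move: bP; rewrite mem_filter mem_iota mem_rcons inE negb_or.
  by case/andP=> /andP[_ ->] /= ->.
case/andP: bP => ltbm bNu.
by rewrite mem_filter mem_iota mem_rcons inE negb_or bNu ltbm ltn_eqF.
Qed.

Lemma sort_leq_cons (x : nat) (s : seq nat) :
  all (leq x) s -> sort leq (x :: s) = x :: sort leq s.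
Proof.
move=> xs; apply: (sorted_eq leq_trans anti_leq) => /=.
- exact: sort_sorted leq_total _.
- rewrite path_sortedE; last exact: leq_trans.
  by rewrite all_sort xs sort_sorted //; apply: leq_total.
- by rewrite perm_sort perm_cons perm_sym perm_sort.
Qed.

Lemma map_sort_leq (f : nat -> nat) (s : seq nat) :
  {homo f : x y / x <= y} -> map f (sort leq s) = sort leq (map f s).
Proof.
move=> f_homo; apply: (sorted_eq leq_trans anti_leq).
- exact: homo_sorted f_homo _ (sort_sorted leq_total s).
- exact: sort_sorted leq_total _.
- by rewrite perm_sym perm_sort; apply: perm_map; rewrite perm_sym perm_sort.
Qed.

Lemma sumn_map_leq (f : nat -> nat) (s : seq nat) :
  (forall x, f x <= x) -> sumn (map f s) <= sumn s.
Proof. by move=> fle; elim: s => //= x s IHs; apply: leq_add. Qed.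

Lemma mem_map_sub1 (s : seq nat) (c : nat) :
  all (leq 1) s -> (c \in [seq x - 1 | x <- s]) = (c.+1 \in s).
Proof.
move=> /allP s_gt0; apply/mapP/idP => [[x xs ->]|cs].
  by rewrite subn1 prednK // s_gt0.
by exists c.+1; rewrite ?subn1.
Qed.

(** The number of coins varies in the induction: besides the options of [x :: t], it reaches those
    of the shifted position, which have one coin fewer. *)
Lemma grundy_shift (x : nat) (t : seq nat) :
  position (x :: t) -> x <= size t ->
  grundy (x :: t) = grundy [seq y - 1 | y <- t].
Proof.
have [n] := ubnP (sumn (x :: t)); elim: n => // n IHn in x t *.
(* A single coin has [x = 0], so both sides are the mex of no options. *)
case/lastP: t => [|u m]; first by rewrite leqn0 => _ _ /eqP->; rewrite !grundyE.
rewrite ltnS => le_n xum le_x; rewrite size_rcons in le_x.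
have IHopt y s : y :: s \in options (x :: rcons u m) -> y <= size s ->
    grundy (y :: s) = grundy [seq z - 1 | z <- s].
  move=> yso; apply: IHn (position_options xum yso).
  by apply: leq_trans le_n; apply/ltP; apply: sumn_options.
have sub1_homo : {homo subn^~ 1 : y z / y <= z} by move=> y z; apply: leq_sub2r.
have [shift_pos um_gt0] := position_shift xum.
have : path ltn x (rcons u m) by [].
rewrite (path_sortedE ltn_trans) all_rcons => /andP[/andP[ltxm xu] _].
have u_gt0 : all (leq 1) u by move: um_gt0; rewrite /= all_rcons => /andP[].
have memL b : b < m -> b \notin x :: u ->
    sort leq [:: b, x & u] \in options (x :: rcons u m).
  move=> bm bN; rewrite -rcons_cons; apply/mem_options_rcons.
  by exists b; rewrite ?bm.
(* For [b > x] the coin [x] stays leftmost, so induction deletes [x] and lowers [b] and [u] by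
   one. *)
have highE b : b < m -> b \notin x :: u -> x < b ->
    grundy (sort leq [:: b, x & u]) =
    grundy (sort leq (b - 1 :: [seq y - 1 | y <- u])).
  move=> bm bN xb; have := memL b bm bN.
  have -> : sort leq [:: b, x & u] = x :: sort leq (b :: u).
    rewrite -sort_leq_cons /=; last first.
      by rewrite ltnW //; apply: sub_all xu => y /ltnW.
    apply/(perm_sortP leq_total leq_trans anti_leq).
    exact: permEl (perm_catCA [:: b] [:: x] u).
  by move=> /IHopt->; rewrite ?size_sort // map_sort_leq.
(* For [b < x] the new coin is leftmost and is the one deleted, so the value does not depend on
   [b]. *)
have lowE b : b < x ->
    grundy (sort leq [:: b, x & u]) =
    grundy (x - 1 :: [seq y - 1 | y <- u]).
  move=> bx; have bu : all (ltn b) (x :: u).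
    by rewrite /= bx; apply: sub_all xu => y; apply: ltn_trans.
  have bN : b \notin x :: u by apply/negP => /(allP bu); rewrite /= ltnn.
  have := memL b (ltn_trans bx ltxm) bN.
  have -> : sort leq [:: b, x & u] = [:: b, x & u].
    apply: (sorted_sort leq_trans) => /=; rewrite ltnW //=.
    rewrite (path_sortedE leq_trans) (sub_all _ xu) //=; last by move=> y /ltnW.
    move: xum; rewrite /position ltn_sorted_uniq_leq => /andP[_].
    move=> /path_sorted /=; rewrite -cats1.
    by move=> /(subseq_sorted leq_trans); apply; apply: prefix_subseq.
  by move=> /IHopt-> //=; rewrite (leq_trans (ltnW bx)).
have shiftE : [seq y - 1 | y <- rcons u m] = rcons [seq y - 1 | y <- u] (m - 1).
  exact: map_rcons.
have u'_sorted : sorted leq [seq y - 1 | y <- u].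
  move: shift_pos; rewrite /= shiftE /position ltn_sorted_uniq_leq => /andP[_].
  rewrite -cats1 => /(subseq_sorted leq_trans); apply; exact: prefix_subseq.
have u'_ge : all (leq x) [seq y - 1 | y <- u].
  by rewrite all_map; apply: sub_all xu => y /= xy; rewrite leq_subRL; lia.
(* Square [c] is free after the shift because [c.+1 <= x] lies below every coin of [u]; also
   [c < x <= m - 1]. *)
have memR c : c < x ->
    c :: [seq y - 1 | y <- u] \in options [seq y - 1 | y <- rcons u m].
  move=> cx; rewrite shiftE; apply/mem_options_rcons; exists c.
    rewrite mem_map_sub1 //; apply/andP; split; first lia.
    by apply/negP => /(allP xu) /=; lia.
  rewrite sort_leq_cons ?(sorted_sort leq_trans) //.
  by apply: sub_all u'_ge => y; apply: leq_trans; apply: ltnW.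
(* From [c < x <= (size u).+1] comes [c <= size u], the bound induction needs here. Shifting does
   not increase the sum, so these options stay below the induction bound. *)
have rightE c : c < x ->
    grundy (c :: [seq y - 1 | y <- u]) =
    grundy [seq y - 1 | y <- [seq y - 1 | y <- u]].
  move=> cx; have cR := memR c cx.
  apply: IHn (position_options shift_pos cR) _; last by rewrite size_map; lia.
  apply: leq_trans le_n; have /ltP/leq_trans -> // := sumn_options cR.
  apply: leq_trans (leq_addl _ _).
  by apply: sumn_map_leq => y; apply: leq_subr.
rewrite [LHS]grundyE [RHS]grundyE; apply: eq_mex => v.
apply/mapP/mapP => -[q].
  rewrite -rcons_cons => /mem_options_rcons[b /andP[bm bN] ->] ->.
  have [xb|bx|bEx] := ltngtP x b; last by rewrite bEx mem_head in bN.
    exists (sort leq (b - 1 :: [seq y - 1 | y <- u])); last exact: highE.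
    rewrite shiftE; apply/mem_options_rcons; exists (b - 1) => //.
    rewrite mem_map_sub1 // -subSn ?subSS ?subn0; last lia.
    by move: bN; rewrite inE negb_or => /andP[_ ->]; lia.
  (* All low moves share one witness, the shifted coin sent to [x - 1]; it exists since [b < x]
     forces [0 < x]. *)
  by exists (x - 1 :: [seq y - 1 | y <- u]); [apply: memR; lia | apply: lowE].
rewrite shiftE => /mem_options_rcons[c /andP[cm cN] ->] ->.
rewrite mem_map_sub1 // in cN.
have [xc|cx] := leqP x c.
  have c1N : c.+1 \notin x :: u by rewrite inE negb_or cN andbT; lia.
  exists (sort leq [:: c.+1, x & u]); first by apply: memL => //; lia.
  by rewrite highE ?subn1 //; lia.
(* The witness moves to [c], not [c.+1], which could be the occupied square [x]. By [lowE] its value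
   is that of the shifted option at [x - 1], and [rightE] at [x - 1] and at [c] gives the same
   value. *)
exists (sort leq [:: c, x & u]).
  apply: memL; first lia.
  by apply/negP; rewrite inE => /orP[/eqP|/(allP xu) /=]; lia.
rewrite lowE // [RHS]rightE; last lia.
rewrite sort_leq_cons ?(sorted_sort leq_trans) ?rightE //.
by apply: sub_all u'_ge => y; apply: leq_trans; apply: ltnW.
Qed.

Theorem theorem3 (k : nat) (a : k.-tuple nat)
    (k_ge3 : 3 <= k) (a_pos : position a) (a1_le : nth 0 a 0 <= k - 1) :
  grundy a = grundy [seq x - 1 | x <- behead a].
Proof.
have := size_tuple a.
case: (tval a) a_pos a1_le => [|x t] //= xt_pos x_le k_eq.
by apply: grundy_shift => //; rewrite -k_eq subn1 in x_le.
Qed.
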